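(* Let $k\geq 2$ be an integer. Consider the game of $\frac1k$-majority on-line edge-colouring of a graph in which the Presenter must construct a final graph with minimum degree $\delta=k\ell+j$, where $\ell\geq 1$ is an integer and $j\in\{0,\dotsc,k-1\}$. Then the Algorithm has a strategy using at most \[ 2\left(k+\left\lfloor\frac{k-2}{\ell}\right\rfloor\right)+1 \] colours against any strategy of the Presenter. That is, there is an on-line strategy for the Algorithm using colours from a fixed set of this many colours such that, whatever the Presenter does, the colouring of the final graph is a $\frac1k$-majority edge-colouring.
   Context: All graphs are finite and simple. For an integer $k\geq 2$, a $\frac1k$-majority edge-colouring of a graph $G$ is a (not necessarily proper) colouring of the edges of $G$ such that, for every vertex $v$ of $G$ and every colour $c$, at most $d_G(v)/k$ of the edges incident with $v$ have colour $c$. On-line game with minimum degree $\delta\geq k$: the integers $k$ and $\delta$ are fixed and known to both players before the game. Two players, the Presenter and the Algorithm, start with an edgeless graph. In each round the Presenter reveals one new edge, possibly using previously unused vertices; its endpoints are identified to the Algorithm. The Algorithm must immediately and irrevocably assign a colour to this edge, knowing only the part of the graph revealed so far and its colouring. The Presenter may choose each edge depending on the whole history of the game, including all colours assigned so far. After finitely many rounds the Presenter ends the game; the graph formed by all revealed edges is the final graph (it has no vertices of degree $0$), and its minimum degree must equal $\delta$. Vertices of smaller degree may appear during the game. The Algorithm's goal is that the resulting colouring of the final graph is a $\frac1k$-majority edge-colouring. *)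

(* Defs.v *)
From mathcomp Require Import all_boot all_order all_algebra.
From mathcomp Require Import finmap.

Set Implicit Arguments.
Unset Strict Implicit.
Unset Printing Implicit Defensive.

Local Open Scope fset_scope.
Local Open Scope fmap_scope.

(* Vertices are natural numbers, so that unused vertices never run out. An
   edge is a two-element set of vertices; cardinality 2 is imposed on the moves
   of the Presenter, see [legal]. *)
Definition edge := {fset nat}.

(* A graph without isolated vertices is given by its set of edges. *)
Definition vertices (E : {fset edge}) : {fset nat} := \bigcup_(e <- E) e.

Definition degree (E : {fset edge}) (v : nat) : nat :=
  #|` [fset e in E | v \in e]|.

Definition has_min_degree (E : {fset edge}) (d : nat) : Prop :=
  (exists2 v, v \in vertices E & degree E v = d) /\
  (forall v, v \in vertices E -> d <= degree E v).

(* An edge-coloured graph is a finite map from its edge set [domf G] to the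
   colours. *)
Definition colour_degree (C : eqType) (G : {fmap edge -> C}) (v : nat) (c : C)
    : nat :=
  #|` [fset e in domf G | (v \in e) && (G.[? e] == Some c)]|.

Definition majority_edge_colouring (C : eqType) (k : nat)
    (G : {fmap edge -> C}) : Prop :=
  forall (v : nat) (c : C), v \in vertices (domf G) ->
    ((colour_degree G v c)%:R <= (degree (domf G) v)%:R / k%:R :> rat)%R.

(* The Algorithm sees the coloured graph revealed so far and the new edge. *)
Definition algorithm (C : Type) := {fmap edge -> C} -> edge -> C.

(* The Presenter sees the whole history, that is, the revealed edges with their
   colours in chronological order; [None] ends the game. *)
Definition presenter (C : Type) := seq (edge * C) -> option edge.

Definition coloured_graph (C : Type) (h : seq (edge * C)) : {fmap edge -> C} :=
  foldl (fun G m => G.[m.1 <- m.2]) fmap0 h.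

(* The history after [n] rounds, constant once the Presenter has ended the
   game. *)
Fixpoint history (C : Type) (A : algorithm C) (P : presenter C) (n : nat)
    : seq (edge * C) :=
  if n is m.+1 then
    let h := history A P m in
    if P h is Some e then rcons h (e, A (coloured_graph h) e) else h
  else [::].

Definition legal (C : Type) (A : algorithm C) (P : presenter C) : Prop :=
  forall n e, P (history A P n) = Some e ->
    #|` e| = 2 /\ e \notin domf (coloured_graph (history A P n)).

Definition ends_with (C : Type) (A : algorithm C) (P : presenter C)
    (G : {fmap edge -> C}) : Prop :=
  exists2 n, P (history A P n) = None & G = coloured_graph (history A P n).

(* Main.v *)
Require Import Defs.
From mathcomp Require Import all_boot all_order all_algebra.
From mathcomp Require Import finmap zify.

(** Put [M = k + (k - 2) %/ l] and [t = M + 1].  The Algorithm keeps every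
    colour class at every vertex [v] within the ceiling of [d(v) / t], a bound
    that makes sense at each moment of the game, whatever degrees come later.

    Such a strategy exists by counting.  At a vertex of degree [d] a colour can
    be used once more unless [d < colour_degree * t]; as the colour degrees
    add up to [d], fewer than [t] colours are blocked in this way
    ([card_saturated]).  The two ends of a new edge therefore block at most
    [2 * M] colours, and one of the [2 * M + 1] colours is free at both
    ([unsaturated_colour]); using it preserves the bound
    ([balanced_add_edge]).

    Finally, the ceiling of [d / t] is at most the floor of [d / k] as soon as
    [k * l <= d] ([balanced_majority_bound]): if [q >= l] is this floor, then
    [d <= k * q + (k - 1)], and [k - 1 <= l * (t - k) <= q * (t - k)] by the
    choice of [M], so [d <= q * t]. *)

Set Implicit Arguments.
Unset Strict Implicit.
Unset Printing Implicit Defensive.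

Lemma degree_sum (E : {fset edge}) (v : nat) :
  degree E v = \sum_(e <- E | v \in e) 1.
Proof. by rewrite /degree card_fset_sum1 [RHS]big_fset_condE. Qed.

Lemma colour_degree_sum (C : eqType) (G : {fmap edge -> C}) v c :
  colour_degree G v c
    = \sum_(e <- domf G | (v \in e) && (G.[? e]%fmap == Some c)) 1.
Proof. by rewrite /colour_degree card_fset_sum1 [RHS]big_fset_condE. Qed.

Lemma degree_add_edge (E : {fset edge}) e v :
  e \notin E -> degree (e |` E)%fset v = (v \in e) + degree E v.
Proof.
move=> eE; rewrite !degree_sum big_mkcond big_fsetU1 //= -big_mkcond /=.
by case: (v \in e).
Qed.

Lemma colour_degree_add_edge (C : eqType) (G : {fmap edge -> C}) e c v b :
  e \notin domf G ->
  colour_degree G.[e <- c]%fmap v b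
    = (v \in e) && (c == b) + colour_degree G v b.
Proof.
move=> eG; rewrite !colour_degree_sum.
under eq_bigl do rewrite fnd_set.
rewrite dom_setf big_mkcond big_fsetU1 //= eqxx -[Some c == _]/(c == b).
congr (_ + _).
rewrite [RHS]big_mkcond; apply: eq_big_seq => f fG.
case: (f =P e) => // fe.
by rewrite -fe fG in eG.
Qed.

Lemma sum_colour_degree (C : finType) (G : {fmap edge -> C}) v :
  \sum_c colour_degree G v c = degree (domf G) v.
Proof.
rewrite degree_sum (eq_bigr _ (fun c _ => colour_degree_sum G v c)).
under eq_bigr do rewrite big_mkcond.
rewrite exchange_big /= [RHS]big_mkcond; apply: eq_big_seq => e eG.
rewrite in_fnd; case: (v \in e) => /=; last by rewrite big1.
rewrite (bigD1 (G.[eG]%fmap)) //= eqxx big1 // => c cNe.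
by rewrite -[Some _ == _]/(_ == c) eq_sym (negbTE cNe).
Qed.

(** Using the colour [c] once more at [v] would make its class larger than the
    ceiling of [(degree + 1) / t]. *)
Definition saturated (C : eqType) (t : nat) (G : {fmap edge -> C}) v c : bool :=
  degree (domf G) v < colour_degree G v c * t.

(** Each saturated colour takes more than the fraction [1 / t] of the degree, so
    there are not [t] of them. *)
Lemma card_saturated (C : finType) t (G : {fmap edge -> C}) v :
  0 < t -> #|[set c | saturated t G v c]| <= t.-1.
Proof.
move=> t_gt0; set S := [set c | _]; set d := degree (domf G) v.
have le_d : #|S| * d.+1 <= d * t.
  rewrite -sum_nat_const {2}/d -sum_colour_degree big_distrl /=.
  rewrite [leqRHS](bigID (mem S)) /=.
  apply: leq_trans (leq_addr _ _); apply: leq_sum => c.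
  by rewrite inE.
nia.
Qed.

(** Union bound over the ends of [e], each of which blocks at most [t - 1]
    colours. *)
Lemma unsaturated_colour (C : finType) t (G : {fmap edge -> C}) (e : edge) :
  0 < t -> #|` e| * t.-1 < #|C| ->
  exists c, all (fun v => ~~ saturated t G v c) e.
Proof.
move=> t_gt0 few; pose S v := [set c | saturated t G v c].
have card_S : #|\bigcup_(v <- e) S v| <= #|` e| * t.-1.
  have -> : (#|` e| * t.-1 = \sum_(v <- e) t.-1)%N.
    by rewrite big_const_seq count_predT iter_addn_0 mulnC.
  elim/big_ind2: _ => [|X m Y n leXm leYn|v _]; first by rewrite cards0.
    by apply: leq_trans (leq_card_setU _ _) _; exact: leq_add.
  exact: card_saturated.
have /set0Pn[c cS] : ~: (\bigcup_(v <- e) S v) != set0.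
  by rewrite -card_gt0 cardsCs setCK subn_gt0; exact: leq_ltn_trans few.
exists c; apply/allP => v ve; apply/negP => sat_c.
move: cS; rewrite inE (perm_big _ (perm_to_rem ve)) big_cons.
by rewrite !inE sat_c.
Qed.

(** The default colour [c0] only makes the function total. *)
Definition balanced_algorithm (C : finType) (t : nat) (c0 : C) : algorithm C :=
  fun G e => odflt c0 [pick c | all (fun v => ~~ saturated t G v c) e].

Lemma balanced_algorithmP (C : finType) t (c0 : C) (G : {fmap edge -> C}) e v :
  0 < t -> #|` e| * t.-1 < #|C| -> v \in e ->
  ~~ saturated t G v (balanced_algorithm t c0 G e).
Proof.
move=> t_gt0 few ve; rewrite /balanced_algorithm; case: pickP => [c /allP|none].
  exact.
by have [c] := unsaturated_colour G t_gt0 few; rewrite none.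
Qed.

(** Every colour class at [v] is at most the ceiling of [degree / t]. *)
Definition balanced (C : eqType) (t : nat) (G : {fmap edge -> C}) : Prop :=
  forall v c, colour_degree G v c * t <= degree (domf G) v + t.-1.

(** At an end of [e] where [c] is not saturated, that is,
    [colour_degree * t <= degree], adding one to both the class and the degree
    yields exactly the new bound; elsewhere the class does not grow. *)
Lemma balanced_add_edge (C : eqType) t (G : {fmap edge -> C}) e c :
  0 < t -> e \notin domf G -> balanced t G ->
  {in e, forall v, ~~ saturated t G v c} -> balanced t G.[e <- c]%fmap.
Proof.
move=> t_gt0 eG balG free v b; have := balG v b.
rewrite colour_degree_add_edge // dom_setf degree_add_edge //.
case: (boolP (v \in e)) => [/free|_] //=; rewrite /saturated -leqNgt.
by case: eqP => [<-|_] /=; lia.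
Qed.

Lemma balanced_history (C : finType) t (c0 : C) (P : presenter C) n :
  0 < t -> 2 * t.-1 < #|C| -> legal (balanced_algorithm t c0) P ->
  balanced t (coloured_graph (history (balanced_algorithm t c0) P n)).
Proof.
move=> t_gt0 few leg; elim: n => [|n IHn] /=.
  by move=> v c; rewrite colour_degree_sum big_mkcond big_seq_fset0 mul0n.
case Pn: (P _) => [e|] //; have [e2 eG] := leg n e Pn.
rewrite /coloured_graph foldl_rcons; apply: balanced_add_edge => // v.
by apply: balanced_algorithmP => //; rewrite e2.
Qed.

(** If [x <= l], then [x * k <= k * l <= d].  Otherwise [x = q + 1] with
    [q >= l], and [d < x * k] would give [q * t < d < q * k + k], hence
    [q * (t - k) < k - 1], although
    [q * (t - k) >= l * (1 + (k - 2) %/ l) >= k - 1]. *)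
Lemma balanced_majority_bound k l d x (t := (k + (k - 2) %/ l).+1) :
  1 < k -> 0 < l -> k * l <= d -> x * t <= d + t.-1 -> x * k <= d.
Proof.
move=> k_gt1 l_gt0 le_d; rewrite {}/t.
have := ltn_ceil (k - 2) l_gt0; set a := _ %/ _ => lt_k bal.
rewrite leqNgt; apply/negP => d_lt.
have lt_lx : l < x by nia.
case: x lt_lx bal d_lt => // q; rewrite ltnS => le_lq bal d_lt.
have : a.+1 * l <= a.+1 * q by rewrite leq_mul2l le_lq orbT.
nia.
Qed.

Theorem theorem7 (k l j : nat) (hk : 2 <= k) (hl : 1 <= l) (hj : j < k) :
  exists A : algorithm 'I_(2 * (k + (k - 2) %/ l) + 1),
    forall (P : presenter 'I_(2 * (k + (k - 2) %/ l) + 1))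
      (G : {fmap edge -> 'I_(2 * (k + (k - 2) %/ l) + 1)}),
      legal A P -> ends_with A P G ->
      has_min_degree (domf G) (k * l + j) ->
      majority_edge_colouring k G.
Proof.
have c0 : 'I_(2 * (k + (k - 2) %/ l) + 1).
  by exists 0; rewrite addn1.
exists (balanced_algorithm (k + (k - 2) %/ l).+1 c0) => P G leg [n _ ->].
set H := coloured_graph _ => -[_ min_deg] v c vH.
rewrite Num.Theory.ler_pdivlMr ?Num.Theory.ltr0n; last by apply: ltnW.
rewrite -GRing.natrM Num.Theory.ler_nat.
apply: balanced_majority_bound hk hl _ _.
  exact: leq_trans (leq_addr j _) (min_deg v vH).
by apply: balanced_history => //; rewrite card_ord addn1.
Qed.
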